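(* Let $\phi:\mathbb R\to[0,\infty)$ be even, continuous, non-decreasing on $[0,\infty)$, with $\phi(x)/|x|\to\infty$ as $|x|\to\infty$, and let $B\in\mathbb R$ with $\phi(0)<B$. With $r(\Delta)$, $r_M(\Delta)$, $r_M'(\Delta)$ as defined in the context for this pair $(\phi,B)$, for every $\Delta>0$, $$r(\Delta)\;\le\; r_M'(\Delta)\;\le\; r_M(\Delta)\;\le\; r(\Delta).$$
   Context: For $\mu\in\mathbb R$, $\mathcal C_\mu$ is the set of Borel probability measures $P$ on $\mathbb R$ with $\int x\,dP=\mu$ and $\int\phi(x-\mu)\,dP\le B$. Two-point exponent: $r(\Delta):=-\log\sup\{\rho(P_-,P_+): P_-\in\mathcal C_{-\Delta},\,P_+\in\mathcal C_{\Delta}\}$, where $\rho(P_-,P_+)=\int\sqrt{dP_-\,dP_+}$ is the Hellinger affinity, i.e. $\int\sqrt{p_-p_+}\,d\omega$ with $p_\pm=dP_\pm/d\omega$ for any common dominating measure $\omega$. Best rate of monotone $M$-estimators: $r_M(\Delta)$ is the supremum of all $r\in\mathbb R$ for which there exists a non-decreasing $\psi:\mathbb R\to\mathbb R$ with $$\sup_{P\in\mathcal C_0}\log E_P[e^{\psi(X-\Delta)}]+r\le0,\qquad \sup_{P\in\mathcal C_0}\log E_P[e^{-\psi(X+\Delta)}]+r\le0 .$$ Synthesis rate: for $\lambda=(\lambda_1,\lambda_2)\in\mathbb R\times[0,\infty)$ put $g_u^\lambda(x)=1+\lambda_1x+\lambda_2(\phi(x)-B)$ and $g_l^\lambda(x)=1-\lambda_1x+\lambda_2(\phi(x)-B)$.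 Let $C$ be the set of $\lambda\in\mathbb R\times[0,\infty)$ with $g_u^\lambda(x)>0$ and $g_l^\lambda(x)>0$ for all $x\in\mathbb R$. For $\lambda\in C$ set $\psi_u^\lambda(x)=\log g_u^\lambda(x+\Delta)$ and $\psi_l^\lambda(x)=-\log g_l^\lambda(x-\Delta)$. Then $r_M'(\Delta)$ is the supremum of all $r\in\mathbb R$ for which there exist $\lambda\in C$ and a non-decreasing $\psi:\mathbb R\to\mathbb R$ with $\psi_l^\lambda(x)+r\le\psi(x)\le\psi_u^\lambda(x)-r$ for all $x\in\mathbb R$. *)

(* Defs.v *)
From HB Require Import structures.
From mathcomp Require Import all_boot all_order all_algebra.
From mathcomp Require Import all_classical all_reals all_analysis.
From mathcomp Require Import measurable_realfun measurable_fun_approximation.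
Set Implicit Arguments.
Unset Strict Implicit.
Unset Printing Implicit Defensive.
Import Order.TTheory GRing.Theory Num.Theory.
Import numFieldNormedType.Exports.
Local Open Scope classical_set_scope.
Local Open Scope charge_scope.
Local Open Scope ring_scope.
Local Open Scope ereal_scope.

Section hellinger.
Context d (T : measurableType d) (R : realType).

Definition sum_measure (P Q : {finite_measure set T -> \bar R}) :
  set T -> \bar R := measure_add P Q.

Section sum_measure_instances.
Variables P Q : {finite_measure set T -> \bar R}.

HB.instance Definition _ := Measure.on (sum_measure P Q).

Lemma sum_measureE A : sum_measure P Q A = P A + Q A.
Proof. exact: measure_addE. Qed.

Let sum_measure_fin : fin_num_fun (sum_measure P Q).
Proof.
move=> A mA; rewrite sum_measureE.
by rewrite fin_numD !fin_num_measure.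
Qed.

HB.instance Definition _ :=
  @Measure_isFinite.Build _ _ _ (sum_measure P Q) sum_measure_fin.

End sum_measure_instances.

(* The common dominating measure chosen here is P + Q; lemma
   [hellinger_affinityE] below shows that the choice is immaterial. *)
Definition hellinger_affinity (P Q : {finite_measure set T -> \bar R}) :
    \bar R :=
  \int[sum_measure P Q]_x
    sqrte (('d (charge_of_finite_measure P) '/d (sum_measure P Q)) x *
           ('d (charge_of_finite_measure Q) '/d (sum_measure P Q)) x).


Section independence.
Variables P Q : {finite_measure set T -> \bar R}.
Local Notation PQ := (sum_measure P Q).

Lemma null_dominates_sum_measurel : P `<< PQ.
Proof.
apply/null_content_dominatesP => A mA.
rewrite /= sum_measureE => /eqP.
by rewrite padde_eq0 ?measure_ge0// => /andP[/eqP].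
Qed.

Lemma null_dominates_sum_measurer : Q `<< PQ.
Proof.
apply/null_content_dominatesP => A mA.
rewrite /= sum_measureE => /eqP.
by rewrite padde_eq0 ?measure_ge0// => /andP[_ /eqP].
Qed.

Let f : T -> \bar R := Radon_Nikodym_SigmaFinite.f P PQ.
Let g : T -> \bar R := Radon_Nikodym_SigmaFinite.f Q PQ.

Let mf : measurable_fun setT f.
Proof.
apply: measurable_int; apply: Radon_Nikodym_SigmaFinite.f_integrable.
exact: null_dominates_sum_measurel.
Qed.

Let mg : measurable_fun setT g.
Proof.
apply: measurable_int; apply: Radon_Nikodym_SigmaFinite.f_integrable.
exact: null_dominates_sum_measurer.
Qed.

Let f0 x : 0 <= f x.
Proof.
exact: Radon_Nikodym_SigmaFinite.f_ge0 null_dominates_sum_measurel x.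
Qed.

Let g0 x : 0 <= g x.
Proof.
exact: Radon_Nikodym_SigmaFinite.f_ge0 null_dominates_sum_measurer x.
Qed.

Let measurable_sqrteM (p q : T -> \bar R) :
  measurable_fun setT p -> measurable_fun setT q ->
  measurable_fun setT (fun x => sqrte (p x * q x)).
Proof.
move=> mp mq.
rewrite (_ : (fun _ => _) = (fun x => (maxe (p x * q x) 0) `^ 2^-1)).
  apply: (measurableT_comp (measurable_poweR _)).
  by apply: measurable_maxe => //; exact: emeasurable_funM.
apply/funext => x; rewrite poweR12_sqrt ?le_max ?lexx ?orbT//.
case: (p x * q x) => [r| |]; last 2 first.
- by rewrite max_l ?leey.
- by rewrite max_r ?leNye//= sqrtr0.
have [r0|r0] := leP 0%R r; first by rewrite max_l ?lee_fin.
by rewrite max_r ?lee_fin ?(ltW r0)//= sqrtr0 ler0_sqrtr// ltW.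
Qed.

Lemma hellinger_affinityE (om : {sigma_finite_measure set T -> \bar R})
    (p q : T -> \bar R) :
  measurable_fun setT p -> measurable_fun setT q ->
  (forall x, 0 <= p x) -> (forall x, 0 <= q x) ->
  (forall A, measurable A -> P A = \int[om]_(x in A) p x) ->
  (forall A, measurable A -> Q A = \int[om]_(x in A) q x) ->
  hellinger_affinity P Q = \int[om]_x sqrte (p x * q x).
Proof.
move=> mp mq p0 q0 Pp Qq.
have PQom : PQ `<< om.
  apply/null_content_dominatesP => A mA omA.
  by rewrite /= sum_measureE Pp// Qq//
    !(null_set_integral mA)// ?adde0//; exact: measurable_funTS.
pose h : T -> \bar R := Radon_Nikodym_SigmaFinite.f PQ om.
have h0 x : 0 <= h x by exact: Radon_Nikodym_SigmaFinite.f_ge0.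
have mh : measurable_fun setT h.
  by apply: measurable_int; exact: Radon_Nikodym_SigmaFinite.f_integrable.
have key (S : {finite_measure set T -> \bar R}) (s : T -> \bar R) :
    S `<< PQ -> measurable_fun setT s -> (forall x, 0 <= s x) ->
    (forall A, measurable A -> S A = \int[om]_(x in A) s x) ->
    ae_eq om setT s (Radon_Nikodym_SigmaFinite.f S PQ \* h).
  move=> SPQ ms s0 Ss.
  have mk : measurable_fun setT (Radon_Nikodym_SigmaFinite.f S PQ).
    by apply: measurable_int; exact: Radon_Nikodym_SigmaFinite.f_integrable.
  apply: integral_ae_eq => //.
  - apply/integrableP; split => //.
    under eq_integral do rewrite gee0_abs//.
    by rewrite -Ss// ltey_eq fin_num_measure.
  - exact: emeasurable_funM.
  - move=> E _ mE; rewrite -Ss//.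
    rewrite Radon_Nikodym_SigmaFinite.change_of_variables//.
    + exact: Radon_Nikodym_SigmaFinite.f_integral.
    + exact: Radon_Nikodym_SigmaFinite.f_ge0.
    + exact: measurable_funTS.
transitivity (\int[PQ]_x sqrte (f x * g x)).
  apply: ae_eq_integral => //; [|exact: measurable_sqrteM|].
    apply: measurable_sqrteM; apply: measurable_int;
      apply: Radon_Nikodym_integrable.
      exact: null_dominates_sum_measurel.
    exact: null_dominates_sum_measurer.
  have := ae_eq_Radon_Nikodym_SigmaFinite null_dominates_sum_measurel
    measurableT.
  have := ae_eq_Radon_Nikodym_SigmaFinite null_dominates_sum_measurer
    measurableT.
  by apply: filterS2 => x gx fx _; rewrite /f /g gx// fx.
rewrite -(Radon_Nikodym_SigmaFinite.change_of_variables PQom)//; last 2 first.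
- by move=> x; exact: sqrte_ge0.
- exact: measurable_sqrteM.
apply: ae_eq_integral => //.
- by apply: emeasurable_funM => //; exact: measurable_sqrteM.
- exact: measurable_sqrteM.
have := key _ _ null_dominates_sum_measurel mp p0 Pp.
have := key _ _ null_dominates_sum_measurer mq q0 Qq.
apply: filterS2 => x qx px _; rewrite px// qx//= -/f -/g -/h.
rewrite muleACA [RHS]sqrteM; last by rewrite mule_ge0.
congr (_ * _); have := h0 x; case: (h x) => [r| |]//=.
  by rewrite lee_fin => r0; rewrite -expr2 sqrtr_sqr ger0_norm.
Qed.

End independence.
End hellinger.

Section rates.
Context {R : realType}.
Implicit Types (phi psi : R -> R) (B mu Delta r : R).

Definition moment_class phi B mu : set (probability (measurableTypeR R) R) :=
  [set P : probability (measurableTypeR R) R |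
    [/\ P.-integrable [set: measurableTypeR R] (fun x => (x : R)%:E),
        \int[P]_x (x : R)%:E = mu%:E &
        \int[P]_x (phi ((x : R) - mu)%R)%:E <= B%:E]].

(* The rates are extended reals: [lne 0 = -oo] and suprema are taken in
   [\bar R], so that no junk value of [ln] or [sup] can intervene. *)
Definition two_point_exponent phi B Delta : \bar R :=
  - lne (ereal_sup [set rho | exists Pm Pp,
      [/\ moment_class phi B (- Delta)%R Pm, moment_class phi B Delta Pp &
          rho = hellinger_affinity Pm Pp]]).

Definition monotone_M_rate phi B Delta : \bar R :=
  ereal_sup [set r%:E | r in [set r : R | exists psi : R -> R,
    [/\ {homo psi : x y / (x <= y)%R},
        ereal_sup [set lne ('E_P[fun x : R => expR (psi (x - Delta)%R)]) |
          P in moment_class phi B 0%R] + r%:E <= 0 &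
        ereal_sup [set lne ('E_P[fun x : R => expR (- psi (x + Delta)%R)%R]) |
          P in moment_class phi B 0%R] + r%:E <= 0]]].

Local Open Scope ring_scope.

Definition g_u phi B (la : R * R) (x : R) : R :=
  1 + la.1 * x + la.2 * (phi x - B).

Definition g_l phi B (la : R * R) (x : R) : R :=
  1 - la.1 * x + la.2 * (phi x - B).

Definition multiplier_set phi B : set (R * R) :=
  [set la | 0 <= la.2 /\ forall x, 0 < g_u phi B la x /\ 0 < g_l phi B la x].

Definition psi_u phi B Delta (la : R * R) (x : R) : R :=
  ln (g_u phi B la (x + Delta)).

Definition psi_l phi B Delta (la : R * R) (x : R) : R :=
  - ln (g_l phi B la (x - Delta)).

Definition synthesis_rate phi B Delta : \bar R :=
  ereal_sup [set r%:E | r in [set r : R | exists (la : R * R) (psi : R -> R),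
    [/\ multiplier_set phi B la,
        {homo psi : x y / x <= y} &
        forall x, psi_l phi B Delta la x + r <= psi x /\
                  psi x <= psi_u phi B Delta la x - r]]].

End rates.

(* Main.v *)
(* [synthesis <= M] holds because [g_u] and [g_l] have expectation at most [1]
   on [moment_class phi B 0], and [M <= two-point] is AM-GM:
   [sqrt (p q) <= (e^psi p + e^-psi q) / 2].

   For [two-point <= synthesis], a non-decreasing [psi] fits between
   [psi_l + r] and [psi_u - r] iff [g_u u * g_l v >= e^(2r)] whenever
   [u - v >= 2 Delta].  On the line [u - v = 2 Delta] this says that
   [c + la1 m + la2 s >= 0] on the convex cone of all
     c = sum (a + b) - 2 e^r sum sqrt(ab),
     m = sum a (t + Delta) - b (t - Delta),
     s = sum a (phi (t + Delta) - B) + b (phi (t - Delta) - B)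
   over finite families of masses [a] of [P_-] and [b] of [P_+] at points [t].
   As [phi] is even, such a family can be symmetrised by [t -> -t], [a <-> b];
   hence [r <= two_point_exponent] rules out [c < 0] with [m = 0] and [s <= 0],
   and multipliers exist by separation in dimension 3.  If [la1 < 0] it can be
   replaced by [0], and for [la1 >= 0] the inequality extends from the line to
   the half-plane because [phi] increases with [|x|]. *)
From HB Require Import structures.
Require Import Defs.
From mathcomp Require Import all_boot all_order all_algebra.
From mathcomp Require Import all_classical all_reals all_analysis.
From mathcomp Require Import measurable_realfun ring lra.
Set Implicit Arguments.
Unset Strict Implicit.
Unset Printing Implicit Defensive.
Import Order.TTheory GRing.Theory Num.Theory.
Import numFieldNormedType.Exports.
Local Open Scope classical_set_scope.
Local Open Scope ring_scope.

(** * Separation of convex cones in dimensions two and three *)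

Section multipliers.
Context {R : realType}.

(** A point with [m > 0] and one with [m < 0] combine to a point with [m = 0], where [c >= 0]. Hence
    every slope [- c / m] of the first kind lies below every slope of the second, and the supremum
    of the first kind separates them. *)
Lemma cone_multiplier (K : R -> R -> Prop) :
  (forall c m c' m', K c m -> K c' m' -> K (c + c') (m + m')) ->
  (forall a c m, 0 < a -> K c m -> K (a * c) (a * m)) ->
  (forall c, K c 0 -> 0 <= c) ->
  (exists c m, K c m /\ 0 < m) -> (exists c m, K c m /\ m < 0) ->
  exists l, forall c m, K c m -> 0 <= c + l * m.
Proof.
move=> KD KZ K0 [cp [mp [Kp mp0]]] [cn [mn [Kn mn0]]].
pose S := [set l | exists c m, [/\ K c m, 0 < m & l = - c / m]].
have cross c m c' m' : K c m -> 0 < m -> K c' m' -> m' < 0 ->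
    - c / m <= - c' / m'.
  move=> Kcm m0 Kcm' m'0.
  have m'N0 : 0 < - m' by rewrite oppr_gt0.
  have := K0 (- m' * c + m * c').
  have -> : 0 = - m' * m + m * m' by ring.
  move=> /(_ (KD _ _ _ _ (KZ _ _ _ m'N0 Kcm) (KZ _ _ _ m0 Kcm'))) h.
  rewrite -subr_ge0 (_ : _ - _ = (- m' * c + m * c') / (m * - m')).
    by rewrite divr_ge0//; [lra|rewrite mulr_ge0// ltW].
  by field; rewrite (lt0r_neq0 m0) (ltr0_neq0 m'0).
have Sub : has_sup S.
  split; first by exists (- cp / mp), cp, mp.
  by exists (- cn / mn) => _ [c [m [Kcm m0 ->]]]; exact: cross.
exists (sup S) => c m Kcm; have [m0|m0|m0] := ltgtP m 0.
- have : sup S <= - c / m.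
    apply: ge_sup; first by have [] := Sub.
    by move=> _ [c' [m' [Kcm' m'0 ->]]]; exact: cross.
  by rewrite ler_ndivlMr//; lra.
- have : - c / m <= sup S by apply: ub_le_sup; [case: Sub|exists c, m].
  by rewrite ler_pdivrMr//; lra.
- by rewrite m0 mulr0 addr0; apply: K0; rewrite -m0.
Qed.

(** Two planar separations: [l2] comes from the slice [m = 0], then [l1] from the pairs
    [(c + l2 * s, m)]. The point with [m = 0] and [s < 0] serves as Slater point. *)
Lemma cone_multiplier2 (K : R -> R -> R -> Prop) :
  (forall c m s c' m' s', K c m s -> K c' m' s' ->
    K (c + c') (m + m') (s + s')) ->
  (forall a c m s, 0 < a -> K c m s -> K (a * c) (a * m) (a * s)) ->
  (forall c s, K c 0 s -> s <= 0 -> 0 <= c) ->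
  (exists c m s, [/\ K c m s & 0 < m]) -> (exists c m s, [/\ K c m s & m < 0]) ->
  (exists c s, [/\ K c 0 s & s < 0]) ->
  exists l1 l2, 0 <= l2 /\
    forall c m s, K c m s -> 0 <= c + l1 * m + l2 * s.
Proof.
move=> KD KZ K0 [cp [mp [sp [Kp mp0]]]] [cn [mn [sn [Kn mn0]]]]
  [c0 [s0 [Ks0 s00]]].
(* Relaxing [s] upwards supplies points with [s > 0] and forces [l2 >= 0]. *)
have [l2 l2P] : exists l, forall c s, (exists2 s', K c 0 s' & s' <= s) ->
    0 <= c + l * s.
  apply: cone_multiplier.
  - move=> c s c' s' [u Ku us] [u' Ku' us']; exists (u + u'); last exact: lerD.
    by rewrite -(addr0 0); exact: KD.
  - move=> a c s a0 [u Ku us]; exists (a * u); last by rewrite ler_pM2l.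
    by rewrite -(mulr0 a); exact: KZ.
  - by move=> c [s Ks ?]; exact: K0 Ks _.
  - by exists c0, 1; split => //; exists s0 => //; lra.
  - by exists c0, s0; split => //; exists s0.
have l20 : 0 <= l2.
  rewrite leNgt; apply/negP => l20.
  have c0_ge0 : 0 <= c0 by apply: K0 Ks0 _; exact: ltW.
  (* For this value of [s] the expression [c0 + l2 * s] equals [-1]. *)
  have : 0 <= c0 + l2 * ((c0 + 1) / - l2).
    apply: l2P; exists s0 => //; rewrite (le_trans (ltW s00))//.
    by rewrite divr_ge0//; lra.
  rewrite (_ : l2 * _ = - (c0 + 1)); first lra.
  by field; rewrite lt_eqF.
have [l1 l1P] : exists l, forall c m,
    (exists c' s, K c' m s /\ c = c' + l2 * s) -> 0 <= c + l * m.
  apply: cone_multiplier.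
  - move=> _ m _ m' [c [s [Kc ->]]] [c' [s' [Kc' ->]]].
    by exists (c + c'), (s + s'); split; [exact: KD|ring].
  - move=> a _ m a0 [c [s [Kc ->]]].
    by exists (a * c), (a * s); split; [exact: KZ|ring].
  - by move=> _ [c [s [Kc ->]]]; apply: l2P; exists s.
  - by exists (cp + l2 * sp), mp; split => //; exists cp, sp.
  - by exists (cn + l2 * sn), mn; split => //; exists cn, sn.
exists l1, l2; split => // c m s Kcms.
rewrite addrAC; apply: l1P; by exists c, s.
Qed.

(** The discriminant criterion on the quadrant: for [x > 0] the form is tested in its minimising
    direction [(k, x)], and [x = 0] is excluded by a large [a]. *)
Lemma ge_sqr_of_quadratic_form (x y k : R) : 0 <= x -> 0 < k ->
  (forall a b, 0 <= a -> 0 <= b -> 2 * k * (a * b) <= a ^+ 2 * x + b ^+ 2 * y) ->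
  k ^+ 2 <= x * y.
Proof.
rewrite le_eqVlt => /predU1P[<-|x0] k0 h.
  have y0 : 0 <= y by have := h 0 1 (lexx _) ler01; nra.
  have yk0 : 0 <= (y + 1) / k by rewrite divr_ge0//; lra.
  have := h ((y + 1) / k) 1 yk0 ler01.
  have -> : 2 * k * ((y + 1) / k * 1) = 2 * (y + 1).
    by field; rewrite gt_eqF.
  lra.
have := h k x (ltW k0) (ltW x0) => hk.
have : 0 <= x * (x * y - k ^+ 2) by nra.
by rewrite pmulr_rge0// subr_ge0.
Qed.

End multipliers.

(** * Products of values of a tilted even function *)

Section tilted_even_function.
Context {R : realType} (G : R -> R) (Delta k : R).
Hypotheses (Delta_gt0 : 0 < Delta) (G_even : forall x, G (- x) = G x)
  (G_ndecr : forall x y : R, 0 <= x -> x <= y -> G x <= G y).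

Let tilt_mono (l x y : R) :
  0 <= l -> 0 <= x -> x <= y -> G x + l * x <= G y + l * y.
Proof. by move=> l0 x0 xy; rewrite lerD ?G_ndecr// ler_wpM2l. Qed.

(** The tilted function is non-decreasing on the positive half-line. With [w <= u], either
    [w <= Delta] and [u] can be lowered to [2 * Delta - w], or both arguments exceed [Delta] and are
    compared with [t = 0]. *)
Lemma tilted_mul_ge_halfplane (l : R) : 0 <= l -> (forall x, 0 < G x + l * x) ->
  (forall t, k <= (G (Delta + t) + l * (Delta + t)) *
                  (G (Delta - t) + l * (Delta - t))) ->
  forall u w : R, 2 * Delta <= u + w -> k <= (G u + l * u) * (G w + l * w).
Proof.
move=> l0 h0 hk u w; have D0 := Delta_gt0; wlog wu : u w / w <= u => [hw uw|uw].
  have [wu|/ltW wu] := leP w u; first exact: hw.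
  by rewrite mulrC; apply: hw => //; rewrite addrC.
have [wD|Dw] := leP w Delta.
  have := hk (Delta - w); rewrite subKr => /le_trans; apply.
  rewrite ler_wpM2r// ?tilt_mono//; first exact: ltW.
  - lra.
  - lra.
have := hk 0; rewrite addr0 subr0 => /le_trans; apply.
by apply: ler_pM; rewrite ?tilt_mono ?(ltW (h0 _))//; lra.
Qed.

(* Decreasing the slope of a negatively tilted function to [0] can only
   help: the factor of larger modulus has a positive argument. *)
Lemma untilted_mul_ge (l : R) : l <= 0 -> (forall x, 0 < G x + l * x) ->
  (forall t, k <= (G (Delta + t) + l * (Delta + t)) *
                  (G (Delta - t) + l * (Delta - t))) ->
  (forall x, 0 < G x) /\ forall t, k <= G (Delta + t) * G (Delta - t).
Proof.
move=> l0 h0 hk; have D0 := Delta_gt0.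
have hG x : 0 <= x -> G x + l * x <= G x.
  by move=> x0; rewrite gerDl mulr_le0_ge0.
have Gp x : 0 <= x -> 0 < G x by move=> x0; exact: lt_le_trans (h0 x) (hG _ x0).
have G0 x : 0 < G x.
  by have [/Gp//|/ltW] := leP 0 x; rewrite -oppr_ge0 => /Gp; rewrite G_even.
split => // t; wlog t0 : t / 0 <= t => [hw|].
  have [/hw//|/ltW] := leP 0 t; rewrite -oppr_ge0 => /hw.
  by rewrite opprK mulrC.
have [tD|Dt] := leP t Delta.
  apply: le_trans (hk t) _.
  by rewrite ler_pM ?(ltW (h0 _))// hG//; lra.
(* For [t > Delta] the argument [Delta - t] is negative and dropping the tilt no longer raises that
   factor. The comparison is with [t = Delta], whose arguments [2 * Delta] and [0] have smaller
   modulus. *)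
have := hk Delta; rewrite subrr => /le_trans; apply.
rewrite ler_pM ?(ltW (h0 _))//.
- by rewrite (le_trans (hG _ _))// ?G_ndecr//; lra.
- by rewrite mulr0 addr0 -(G_even (_ - t)) G_ndecr//; lra.
Qed.

End tilted_even_function.

(** * From multipliers to a monotone function between the envelopes *)

Section synthesis.
Context {R : realType} (phi : R -> R) (B Delta : R).
Hypotheses (phi_even : forall x, phi (- x) = phi x)
  (phi_ndecr : {in `[0, +oo[ &, {homo phi : x y / x <= y}})
  (Delta_gt0 : 0 < Delta).

Let g_uE la x : g_u phi B la x = 1 + la.2 * (phi x - B) + la.1 * x.
Proof. by rewrite /g_u addrAC. Qed.

(** [g_l] is [g_u] reflected, so [g_u u * g_l v] is a product of two values, at [u] and [- v], of
    one tilted even function. *)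
Let g_lE la x : g_l phi B la x = 1 + la.2 * (phi (- x) - B) + la.1 * - x.
Proof. by rewrite /g_l phi_even addrAC mulrN. Qed.

(** [la.2] is kept and [la.1] is replaced by its positive part. *)
Lemma synthesis_of_antidiagonal (la : R * R) (k : R) : 0 <= la.2 -> 0 < k ->
  (forall x, 0 <= g_u phi B la x) -> (forall x, 0 <= g_l phi B la x) ->
  (forall t, k <= g_u phi B la (t + Delta) * g_l phi B la (t - Delta)) ->
  exists2 la', multiplier_set phi B la' &
    forall u v : R, 2 * Delta <= u - v -> k <= g_u phi B la' u * g_l phi B la' v.
Proof.
move=> l20 k0 gu0 gl0 gk.
pose G x := 1 + la.2 * (phi x - B).
have G_even x : G (- x) = G x by rewrite /G phi_even.
have G_ndecr (x y : R) : 0 <= x -> x <= y -> G x <= G y.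
  move=> x0 xy; rewrite lerD2l ler_wpM2l// lerD2r.
  by apply: phi_ndecr => //; rewrite in_itv/= andbT// (le_trans x0).
(* Each value of [g_u] is a factor of a product that is at least [k > 0], so it cannot vanish. *)
have h0 x : 0 < G x + la.1 * x.
  have := gk (x - Delta); rewrite subrK => /(lt_le_trans k0) p.
  rewrite -g_uE lt_neqAle gu0 andbT.
  by apply: contraTneq p => <-; rewrite mul0r ltxx.
have hk t : k <= (G (Delta + t) + la.1 * (Delta + t)) *
                 (G (Delta - t) + la.1 * (Delta - t)).
  by have := gk t; rewrite g_uE g_lE opprB (addrC t).
have fin (l : R) : 0 <= l -> (forall x, 0 < G x + l * x) ->
  (forall t, k <= (G (Delta + t) + l * (Delta + t)) *
                  (G (Delta - t) + l * (Delta - t))) ->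
  exists2 la', multiplier_set phi B la' &
    forall u v : R, 2 * Delta <= u - v -> k <= g_u phi B la' u * g_l phi B la' v.
  move=> l0 hl0 hlk; exists (l, la.2).
    by split => // x; rewrite g_uE g_lE; split; exact: hl0.
  move=> u v uv; rewrite g_uE g_lE.
  exact: (tilted_mul_ge_halfplane (G := G) Delta_gt0 G_ndecr l0 hl0 hlk).
have [l10|/ltW l10] := leP 0 la.1; first exact: (fin la.1).
have [G0 Gk] := untilted_mul_ge Delta_gt0 G_even G_ndecr l10 h0 hk.
apply: (fin 0) => // [x|t]; first by rewrite mul0r addr0.
by rewrite !mul0r !addr0.
Qed.

(** The witness is the least non-decreasing majorant of [psi_l + r], a running supremum; the
    logarithm of the half-plane inequality keeps it below [psi_u - r]. *)
Lemma synthesis_rate_ge (la : R * R) (r : R) : multiplier_set phi B la ->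
  (forall u v : R, 2 * Delta <= u - v ->
    expR r ^+ 2 <= g_u phi B la u * g_l phi B la v) ->
  (r%:E <= synthesis_rate phi B Delta)%E.
Proof.
move=> [l20 g0] gk.
have sep (x y : R) : y <= x ->
    psi_l phi B Delta la y + r <= psi_u phi B Delta la x - r.
  move=> yx; rewrite /psi_l /psi_u.
  have [gu0 _] := g0 (x + Delta); have [_ gl0] := g0 (y - Delta).
  have uv : 2 * Delta <= (x + Delta) - (y - Delta) by lra.
  have := gk _ _ uv.
  rewrite -ler_ln ?posrE ?exprn_gt0 ?expR_gt0 ?mulr_gt0//.
  by rewrite lnM// lnXn ?expR_gt0// expRK mulr2n; lra.
pose S x := [set psi_l phi B Delta la y + r | y in [set y | y <= x]].
have S_sup x : has_sup (S x).
  split; first by exists (psi_l phi B Delta la x + r), x => /=.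
  by exists (psi_u phi B Delta la x - r) => _ [y yx <-]; exact: sep.
apply: ereal_sup_ubound; exists r => //; exists la, (fun x => sup (S x)).
split => //.
- move=> x y xy; apply: le_sup;
    [|by exists (psi_l phi B Delta la x + r), x => /=|exact: S_sup].
  move=> _ [z zx <-]; exists (psi_l phi B Delta la z + r); split => //.
  by exists z => //=; exact: le_trans xy.
- move=> x; split; first by apply: ub_le_sup; [case: (S_sup x)|exists x => /=].
  by apply: ge_sup; [case: (S_sup x)|move=> _ [y yx <-]; exact: sep].
Qed.

End synthesis.

(** * Cauchy-Schwarz and regrouping for finite sums *)

Section finite_sums.
Context {R : realType}.

(** In terms of the square roots [x, y, z, t] of [a, b, c, d], the difference of the squares is
    [(x * t - y * z) ^+ 2]. *)
Lemma sqrtM_add_le (a b c d : R) : 0 <= a -> 0 <= b -> 0 <= c -> 0 <= d ->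
  Num.sqrt (a * b) + Num.sqrt (c * d) <= Num.sqrt ((a + c) * (b + d)).
Proof.
move=> a0 b0 c0 d0; rewrite !sqrtrM ?addr_ge0//.
rewrite -{2}(sqr_sqrtr a0) -{2}(sqr_sqrtr b0) -{2}(sqr_sqrtr c0) -{2}(sqr_sqrtr d0).
move: (Num.sqrt a) (Num.sqrt b) (Num.sqrt c) (Num.sqrt d)
  (sqrtr_ge0 a) (sqrtr_ge0 b) (sqrtr_ge0 c) (sqrtr_ge0 d) => x y z t x0 y0 z0 t0.
rewrite -sqrtrM ?addr_ge0 ?sqr_ge0//.
rewrite -[leLHS]ger0_norm ?addr_ge0 ?mulr_ge0// -sqrtr_sqr.
rewrite ler_wsqrtr// -subr_ge0.
by rewrite (_ : _ - _ = (x * t - y * z) ^+ 2) ?sqr_ge0//; ring.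
Qed.

Lemma sum_sqrtM_le I (s : seq I) (a b : I -> R) :
  (forall i, 0 <= a i) -> (forall i, 0 <= b i) ->
  \sum_(i <- s) Num.sqrt (a i * b i) <=
  Num.sqrt ((\sum_(i <- s) a i) * (\sum_(i <- s) b i)).
Proof.
move=> a0 b0; elim: s => [|i s ih]; first by rewrite !big_nil sqrtr_ge0.
rewrite !big_cons; apply: le_trans (sqrtM_add_le _ _ _ _) => //; last 2 first.
- exact: sumr_ge0.
- exact: sumr_ge0.
by rewrite lerD2l.
Qed.

(** Several indices may share a point: the inner sum collects their total weight, so each distinct
    point must be visited once. *)
Lemma sum_undup_indic I (s : seq I) (x : I -> R) (w : I -> R) (h : R -> R) :
  \sum_(t <- undup (map x s)) h t * (\sum_(i <- s) w i * \1_[set x i] t) =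
  \sum_(i <- s) w i * h (x i).
Proof.
have aux (r : seq R) (y : R) : uniq r -> y \in r ->
    \sum_(t <- r) h t * \1_[set y] t = h y.
  move=> ur yr; rewrite (bigD1_seq y)//= indicE mem_set// mulr1.
  rewrite big1 ?addr0// => t ty; rewrite indicE memNset ?mulr0//.
  by move=> /= E; rewrite E eqxx in ty.
under eq_bigr do rewrite mulr_sumr.
rewrite exchange_big/=.
have : {subset map x s <= undup (map x s)} by move=> t; rewrite mem_undup.
have := undup_uniq (map x s); move: (undup _) => r ur.
elim: s => [|i s ih] sr; first by rewrite !big_nil.
rewrite !big_cons ih; last by move=> t ts; apply: sr; rewrite inE ts orbT.
congr (_ + _); under eq_bigr do rewrite mulrCA.
by rewrite -mulr_sumr aux// sr// inE eqxx.
Qed.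

End finite_sums.

(** * Finitely supported measures and their affinity *)

Section atomic_measures.
Context {R : realType}.
Local Notation mR := (measurableTypeR R).
Implicit Types L : seq (R * {nonneg R}).

Definition atomic L : set mR -> \bar R :=
  msum (fun k => mscale (nth (0, 0%:nng) L k).2
    (dirac ((nth (0, 0%:nng) L k).1 : mR))) (size L).

HB.instance Definition _ L := Measure.on (atomic L).

Lemma atomicE L (A : set mR) :
  atomic L A = (\sum_(p <- L) p.2%:num * \1_A p.1)%:E.
Proof.
rewrite -sumEFin (big_nth (0, 0%:nng)) big_mkord; apply: eq_bigr => i _.
by rewrite /= EFinM.
Qed.

Let atomic_fin_num L : fin_num_fun (atomic L).
Proof. by move=> A _; rewrite atomicE. Qed.

HB.instance Definition _ L :=
  @Measure_isFinite.Build _ _ _ (atomic L) (atomic_fin_num L).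

Lemma ge0_integral_atomic L (D : set mR) (f : mR -> R) :
  measurable D -> measurable_fun D f -> (forall x, 0 <= f x) ->
  (\int[atomic L]_(x in D) (f x)%:E =
   (\sum_(p <- L) p.2%:num * (\1_D p.1 * f p.1))%:E)%E.
Proof.
move=> mD mf f0.
have mEf : measurable_fun D (EFin \o f) by exact/measurable_EFinP.
rewrite /= ge0_integral_measure_sum//; last by move=> x _; rewrite lee_fin.
rewrite -sumEFin (big_nth (0, 0%:nng)) big_mkord; apply: eq_bigr => i _.
rewrite ge0_integral_mscale//=; last by move=> x _; rewrite lee_fin.
by rewrite integral_dirac//= !EFinM.
Qed.

Section atomic_probability.
Variables (L : seq (R * {nonneg R})) (P : probability mR R).
Hypothesis PL : (P : set mR -> \bar R) = atomic L.

Let integral_P (f : mR -> \bar R) : (\int[P]_x f x = \int[atomic L]_x f x)%E.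
Proof. by apply: eq_measure_integral => A _ _; exact: (congr1 (@^~ A) PL). Qed.

Lemma integrable_atomic (f : mR -> R) : measurable_fun setT f ->
  P.-integrable setT (EFin \o f).
Proof.
move=> mf; apply/integrableP; split; first exact/measurable_EFinP.
rewrite integral_P/= ge0_integral_atomic ?ltry//.
exact: measurableT_comp.
Qed.

(** The formula for non-negative functions is applied to the positive and negative parts, both of
    finite integral. *)
Lemma integral_atomic (f : mR -> R) : measurable_fun setT f ->
  (\int[P]_x (f x)%:E = (\sum_(p <- L) p.2%:num * f p.1)%:E)%E.
Proof.
move=> mf; rewrite integral_P integralE.
have m0 : measurable_fun [set: mR] (fun x => Num.max (f x) 0).
  exact: measurable_maxr.
have m1 : measurable_fun [set: mR] (fun x => Num.max (- f x) 0).
  by apply: measurable_maxr => //; exact: measurableT_comp.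
rewrite (eq_integral (fun x => (Num.max (f x) 0)%:E)); last first.
  by move=> x _; rewrite funeposE EFin_max.
rewrite [X in (_ - X)%E](eq_integral (fun x => (Num.max (- f x) 0)%:E)); last first.
  by move=> x _; rewrite funenegE EFin_max.
rewrite !ge0_integral_atomic//; last 2 first.
- by move=> x; rewrite le_max lexx orbT.
- by move=> x; rewrite le_max lexx orbT.
rewrite -EFinB -sumrB; congr EFin; apply: eq_bigr => p _.
rewrite indicT !mul1r -mulrBr; congr (_ * _).
have [f0|/ltW f0] := leP 0 (f p.1).
  by rewrite max_r ?subr0// oppr_le0.
by rewrite max_l ?sub0r ?opprK// oppr_ge0.
Qed.

End atomic_probability.

Lemma atomic_probability L : \sum_(p <- L) p.2%:num = 1 ->
  exists P : probability mR R, (P : set mR -> \bar R) = atomic L.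
Proof.
move=> L1.
have LT : atomic L setT = 1%E.
  by rewrite atomicE; under eq_bigr do rewrite indicT mulr1; rewrite L1.
pose P : probability mR R := HB.pack (atomic L)
  (Measure_isProbability.Build _ _ _ (atomic L) LT).
by exists P.
Qed.

(** With respect to counting measure on the distinct points, the densities are the total masses
    there. Merging entries at one point can only raise the sum of square roots, by Cauchy-Schwarz;
    hence an inequality. *)
Lemma hellinger_affinity_atomic_ge (L : seq (R * {nonneg R} * {nonneg R}))
    (P Q : probability mR R) :
  (P : set mR -> \bar R) = atomic [seq p.1 | p <- L] ->
  (Q : set mR -> \bar R) = atomic [seq (p.1.1, p.2) | p <- L] ->
  ((\sum_(p <- L) Num.sqrt (p.1.2%:num * p.2%:num))%:E <= hellinger_affinity P Q)%E.
Proof.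
move=> PL QL.
pose ts := undup [seq p.1.1 | p <- L].
pose om := atomic [seq (t, NngNum (@ler01 R)) | t <- ts].
pose den (w : R * {nonneg R} * {nonneg R} -> {nonneg R}) (x : mR) : R :=
  \sum_(p <- L) (w p)%:num * \1_[set p.1.1] x.
have den0 w x : 0 <= den w x by apply: sumr_ge0 => p _; rewrite mulr_ge0.
have mden w : measurable_fun [set: mR] (den w).
  apply: measurable_sum => p; apply: measurable_funM => //.
have omE (D : set mR) (f : mR -> R) : measurable D ->
    measurable_fun D f -> (forall x, 0 <= f x) ->
    (\int[om]_(x in D) (f x)%:E = (\sum_(t <- ts) \1_D t * f t)%:E)%E.
  move=> mD mf f0; rewrite ge0_integral_atomic// big_map.
  by under eq_bigr do rewrite mul1r.
have denE w (A : set mR) : measurable A ->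
    (\int[om]_(x in A) (den w x)%:E = (\sum_(p <- L) (w p)%:num * \1_A p.1.1)%:E)%E.
  move=> mA; rewrite omE//; last exact: measurable_funTS.
  by rewrite sum_undup_indic.
rewrite (@hellinger_affinityE _ _ _ P Q om
  (EFin \o den (fun p => p.1.2)) (EFin \o den snd))//; last 6 first.
- exact/measurable_EFinP.
- exact/measurable_EFinP.
- by move=> x; rewrite lee_fin.
- by move=> x; rewrite lee_fin.
- move=> A mA; rewrite denE//; apply: etrans (congr1 (@^~ A) PL) _.
  by rewrite atomicE big_map.
- move=> A mA; rewrite denE//; apply: etrans (congr1 (@^~ A) QL) _.
  by rewrite atomicE big_map.
rewrite /= omE//; last first.
  apply: measurableT_comp; last exact: measurable_funM.
  by apply: continuous_measurable_fun; exact: sqrt_continuous.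
rewrite lee_fin.
(* The left side is regrouped by distinct points, for a comparison point by point. *)
have := sum_undup_indic L (fun p => p.1.1)
  (fun p => Num.sqrt (p.1.2%:num * p.2%:num)) (cst 1).
under [X in _ = X -> _]eq_bigr do rewrite mulr1.
move=> <-; apply: ler_sum => t _; rewrite indicT !mul1r.
have ind0 (p : R * {nonneg R} * {nonneg R}) :
  0 <= \1_[set p.1.1] t :> R by [].
have sqrtE (p : R * {nonneg R} * {nonneg R}) :
    Num.sqrt (p.1.2%:num * p.2%:num) * \1_[set p.1.1] t =
    Num.sqrt ((p.1.2%:num * \1_[set p.1.1] t) * (p.2%:num * \1_[set p.1.1] t)).
  by rewrite mulrACA -expr2 [RHS]sqrtrM ?mulr_ge0// sqrtr_sqr ger0_norm.
under eq_bigr do rewrite sqrtE.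
by apply: sum_sqrtM_le => p; rewrite mulr_ge0.
Qed.

End atomic_measures.

(** * Bounds on the extended logarithm *)

Section lne_bounds.
Context {R : realType}.

Lemma lne_le (x : \bar R) (r : R) : (x <= (expR r)%:E)%E -> (lne x <= r%:E)%E.
Proof.
case: x => [x| |]//; rewrite ?leNye ?leye_eq//= lee_fin => xr.
by case: ifPn => [_|]; rewrite ?leNye// -ltNge => x0; rewrite lee_fin -ler_expR lnK.
Qed.

Lemma le_expR (x : \bar R) (r : R) : (lne x <= r%:E)%E -> (x <= (expR r)%:E)%E.
Proof.
case: x => [x| |]//=; rewrite ?leNye//.
case: ifPn => [x0 _|]; first by rewrite lee_fin (le_trans x0) ?expR_ge0.
by rewrite -ltNge => x0; rewrite !lee_fin => xr; rewrite -[x]lnK// ler_expR.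
Qed.

(** Turns each constraint of [monotone_M_rate] into a uniform bound on exponential moments. *)
Lemma ereal_sup_lne_le T (S : set T) (F : T -> \bar R) (r : R) :
  (ereal_sup [set lne (F t) | t in S] + r%:E <= 0)%E <->
  forall t, S t -> (F t <= (expR (- r))%:E)%E.
Proof.
rewrite -leeBrDr// sub0e -EFinN; split => [h t St|h].
  by apply: le_expR; apply: le_trans h; apply: ereal_sup_ubound; exists t.
by apply: ge_ereal_sup => _ [t St <-]; apply: lne_le; exact: h.
Qed.

End lne_bounds.

(** * The synthesis rate is at most the rate of monotone estimators *)

Lemma homo_measurable {R : realType} (psi : R -> R) :
  {homo psi : x y / x <= y} ->
  measurable_fun [set: measurableTypeR R] psi.
Proof. by move=> h; exact: nondecreasing_measurable. Qed.

Section monotone_rate_bounds.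
Context {R : realType} (phi : R -> R) (B Delta : R).
Hypotheses (phi_ge0 : forall x, 0 <= phi x) (phi_cont : continuous phi).

Lemma phi_measurable : measurable_fun [set: measurableTypeR R] phi.
Proof. exact: continuous_measurable_fun. Qed.

(** By linearity the integral is [1 + l2 * (E phi - B)], since the mean is [0]; [phi] is integrable
    because it is non-negative with bounded integral. *)
Lemma centered_integral_le (P : probability (measurableTypeR R) R) (l1 l2 : R) :
  0 <= l2 -> moment_class phi B 0 P ->
  (forall x : R, 0 <= 1 + l1 * x + l2 * (phi x - B)) ->
  (\int[P]_x (1 + l1 * (x : R) + l2 * (phi x - B))%:E <= 1)%E.
Proof.
move=> l20 [iP EP phiP] g0.
have {}phiP : (\int[P]_x (phi x)%:E <= B%:E)%E.
  by move: phiP; under eq_integral do rewrite subr0.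
have iphi : P.-integrable [set: measurableTypeR R] (EFin \o phi).
  apply/integrableP; split; first by apply/measurable_EFinP; exact: phi_measurable.
  under eq_integral do rewrite /= ger0_norm//.
  by rewrite (le_lt_trans phiP)// ltry.
have i1 : P.-integrable [set: measurableTypeR R] (cst (1 - l2 * B)%:E).
  exact: finite_measure_integrable_cst.
have ix : P.-integrable [set: measurableTypeR R] (fun x => l1%:E * (x : R)%:E)%E.
  exact: integrableZl.
have ip : P.-integrable [set: measurableTypeR R] (fun x => l2%:E * (phi x)%:E)%E.
  exact: integrableZl.
rewrite (eq_integral (fun x : measurableTypeR R =>
  (1 - l2 * B)%:E + l1%:E * (x : R)%:E + l2%:E * (phi x)%:E)%E); last first.
  by move=> x _; rewrite -!EFinM -!EFinD; congr EFin; ring.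
rewrite integralD//; last exact: integrableD.
rewrite integralD// integral_cst// !integralZl//.
rewrite [X in (l1%:E * X)%E]EP mule0 adde0.
rewrite [X in (_ * X + _)%E](_ : _ = 1%E) ?mule1; last exact: probability_setT.
apply: (@le_trans _ _ ((1 - l2 * B)%:E + l2%:E * B%:E)%E).
  by rewrite leeD2l// lee_wpmul2l.
by rewrite -EFinM -EFinD subrK.
Qed.

Lemma synthesis_rate_le_monotone_M_rate :
  (synthesis_rate phi B Delta <= monotone_M_rate phi B Delta)%E.
Proof.
apply: le_ereal_sup => _ [r [la [psi [[l20 g0] psi_mono sw]]] <-].
exists r => //; exists psi.
(* One estimate for both constraints: [l1 = la.1] gives [g_u] and [l1 = - la.1] gives [g_l]. *)
have key (f : R -> R) (l1 : R) (P : probability (measurableTypeR R) R) :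
    measurable_fun [set: measurableTypeR R] f ->
    moment_class phi B 0 P -> (forall x : R, 0 < 1 + l1 * x + la.2 * (phi x - B)) ->
    (forall x : R, f x <= ln (1 + l1 * x + la.2 * (phi x - B)) - r) ->
    ('E_P[fun x : R => expR (f x)] <= (expR (- r))%:E)%E.
  move=> mf PC gp fle; rewrite unlock.
  have ge0 : (0 <= (expR (- r))%:E)%E by rewrite lee_fin expR_ge0.
  rewrite -[leRHS]mule1.
  apply: le_trans (lee_wpmul2l ge0 (centered_integral_le l20 PC (fun x => ltW (gp x)))).
  rewrite -ge0_integralZl//; last 2 first.
  - apply/measurable_EFinP; apply: measurable_funD.
      by apply: measurable_funD => //; exact: measurable_funM.
    apply: measurable_funM => //; apply: measurable_funB => //.
    exact: phi_measurable.
  - by move=> x _; rewrite lee_fin; exact: ltW (gp x).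
  apply: ge0_le_integral => //.
  - by apply/measurable_EFinP; exact: measurableT_comp.
  - apply: emeasurable_funM => //; apply/measurable_EFinP; apply: measurable_funD.
      by apply: measurable_funD => //; exact: measurable_funM.
    apply: measurable_funM => //; apply: measurable_funB => //.
    exact: phi_measurable.
  - move=> x _; rewrite -EFinM lee_fin.
    apply: (@le_trans _ _ (expR (- r + ln (1 + l1 * x + la.2 * (phi x - B))))).
      by rewrite ler_expR addrC.
    by rewrite expRD lnK ?posrE.
split => //.
- apply/ereal_sup_lne_le => P PC; apply: (key (fun x => psi (x - Delta)) la.1) => //.
  + by apply: homo_measurable => x y xy; rewrite psi_mono// lerD2r.
  + by move=> x; case: (g0 x).
  + by move=> x; have [_] := sw (x - Delta); rewrite /psi_u subrK.
- apply/ereal_sup_lne_le => P PC.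
  apply: (key (fun x => - psi (x + Delta)) (- la.1)) => //.
  + apply: measurableT_comp => //.
    by apply: homo_measurable => x y xy; rewrite psi_mono// lerD2r.
  + by move=> x; case: (g0 x) => _; rewrite /g_l mulNr.
  + by move=> x; have [] := sw (x + Delta); rewrite /psi_l addrK /g_l mulNr; lra.
Qed.

End monotone_rate_bounds.

(** * Weighted AM-GM bound on the affinity *)

Section affinity_upper_bound.
Context d (T : measurableType d) (R : realType).
Variables P Q : {finite_measure set T -> \bar R}.
Local Open Scope ereal_scope.
Local Notation f := (Radon_Nikodym_SigmaFinite.f P (sum_measure P Q)).
Local Notation g := (Radon_Nikodym_SigmaFinite.f Q (sum_measure P Q)).

Lemma hellinger_affinity_le (a b : T -> R) :
  measurable_fun setT a -> measurable_fun setT b ->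
  (forall x, 0 <= a x)%R -> (forall x, 0 <= b x)%R ->
  (forall x, 1 <= 4 * (a x * b x))%R ->
  hellinger_affinity P Q <= \int[P]_x (a x)%:E + \int[Q]_x (b x)%:E.
Proof.
move=> ma mb a0 b0 ab.
have PPQ := @null_dominates_sum_measurel _ _ _ P Q.
have QPQ := @null_dominates_sum_measurer _ _ _ P Q.
have f0 x : 0 <= f x by exact: Radon_Nikodym_SigmaFinite.f_ge0.
have g0 x : 0 <= g x by exact: Radon_Nikodym_SigmaFinite.f_ge0.
have mf : measurable_fun setT f.
  by apply: measurable_int; exact: Radon_Nikodym_SigmaFinite.f_integrable.
have mg : measurable_fun setT g.
  by apply: measurable_int; exact: Radon_Nikodym_SigmaFinite.f_integrable.
have mEa : measurable_fun setT (EFin \o a) by exact/measurable_EFinP.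
have mEb : measurable_fun setT (EFin \o b) by exact/measurable_EFinP.
(* This replaces the charge derivatives by [f] and [g], which are non-negative and finite
   everywhere. *)
rewrite (@hellinger_affinityE _ _ _ P Q (sum_measure P Q) f g)//; last 2 first.
- by move=> A mA; exact: Radon_Nikodym_SigmaFinite.f_integral.
- by move=> A mA; exact: Radon_Nikodym_SigmaFinite.f_integral.
rewrite -(Radon_Nikodym_SigmaFinite.change_of_variables PPQ)//.
rewrite -(Radon_Nikodym_SigmaFinite.change_of_variables QPQ)//.
rewrite -ge0_integralD//; last 4 first.
- by move=> x _; rewrite mule_ge0 ?lee_fin.
- exact: emeasurable_funM.
- by move=> x _; rewrite mule_ge0 ?lee_fin.
- exact: emeasurable_funM.
apply: ge0_le_integral => //.
- by move=> x _; exact: sqrte_ge0.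
- under eq_fun => x do rewrite -poweR12_sqrt ?mule_ge0//.
  by apply: (measurableT_comp (measurable_poweR _)); exact: emeasurable_funM.
- by apply: emeasurable_funD; exact: emeasurable_funM.
move=> x _.
have /fineK <- : f x \is a fin_num by exact: Radon_Nikodym_SigmaFinite.f_fin_num.
have /fineK <- : g x \is a fin_num by exact: Radon_Nikodym_SigmaFinite.f_fin_num.
have u0 : (0 <= fine (f x))%R by exact: fine_ge0.
have v0 : (0 <= fine (g x))%R by exact: fine_ge0.
move: (fine (f x)) (fine (g x)) u0 v0 => u v u0 v0.
rewrite -!EFinM -EFinD lee_fin.
have uv0 : (0 <= a x * u + b x * v)%R by rewrite addr_ge0// mulr_ge0.
rewrite -[leRHS]ger0_norm// -sqrtr_sqr ler_sqrt ?sqr_ge0//.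
(* AM-GM: [u v <= 4 (a u) (b v) <= (a u + b v)^2] *)
apply: (@le_trans _ _ (4 * ((a x * u) * (b x * v)))%R).
  rewrite (_ : (4 * _ = 4 * (a x * b x) * (u * v))%R); last by ring.
  by rewrite ler_peMl// mulr_ge0.
by rewrite -subr_ge0 (_ : (_ - _ = (a x * u - b x * v) ^+ 2)%R) ?sqr_ge0//; ring.
Qed.

End affinity_upper_bound.

(** * The rate of monotone estimators is at most the two-point exponent *)

Section monotone_M_upper_bound.
Context {R : realType} (phi : R -> R) (B Delta : R).
Hypotheses (phi_ge0 : forall x, 0 <= phi x) (phi_cont : continuous phi).

(** [Q] is the image of [P] under [x - mu]; it carries the hypotheses at [- Delta] and [Delta] to
    the class at [0] used by the rates. *)
Lemma moment_class_center (mu : R) (P : probability (measurableTypeR R) R) :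
  moment_class phi B mu P ->
  exists2 Q : probability (measurableTypeR R) R, moment_class phi B 0 Q &
    forall f : R -> R, measurable_fun [set: measurableTypeR R] f ->
      (forall x, 0 <= f x) ->
      (\int[Q]_x (f x)%:E = \int[P]_x (f (x - mu))%:E)%E.
Proof.
move=> [iP EP phiP].
have mX : measurable_fun [set: measurableTypeR R]
    ((fun x => x - mu) : measurableTypeR R -> measurableTypeR R).
  exact: measurable_funB.
pose X : {mfun measurableTypeR R >-> measurableTypeR R} :=
  HB.pack (fun x : measurableTypeR R => (x - mu)%R : measurableTypeR R)
    (isMeasurableFun.Build _ _ _ _ _ mX).
have iX : P.-integrable [set: measurableTypeR R] (fun x => ((x : R) - mu)%:E).
  under eq_fun do rewrite EFinB.
  apply: integrableB => //.
  exact: finite_measure_integrable_cst.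
have tr (f : R -> R) : measurable_fun [set: measurableTypeR R] f ->
    (forall x, 0 <= f x) ->
    (\int[distribution P X]_x (f x)%:E = \int[P]_x (f (x - mu))%:E)%E.
  move=> mf f0; rewrite (ge0_integral_distribution X (f := EFin \o f))//.
  exact/measurable_EFinP.
have mE : measurable_fun [set: measurableTypeR R]
    (fun x : measurableTypeR R => (x : R)%:E).
  by apply/measurable_EFinP.
exists (distribution P X) => //; split.
- exact: integrable_pushforward.
- rewrite (integral_distribution (X := X))//.
  rewrite /= (_ : (\int[P]_x _ = \int[P]_x ((x : R)%:E - mu%:E))%E); last first.
    by apply: eq_integral => x _ /=; rewrite EFinB.
  rewrite integralB//; last exact: finite_measure_integrable_cst.
  rewrite [X in (X - _)%E]EP integral_cst//.
  rewrite [X in (_ - _ * X)%E](_ : _ = 1%E) ?mule1; last exact: probability_setT.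
  by rewrite -EFinB subrr.
- under eq_integral do rewrite subr0.
  by rewrite tr//; exact: continuous_measurable_fun.
Qed.

Lemma monotone_M_rate_le_two_point_exponent :
  (monotone_M_rate phi B Delta <= two_point_exponent phi B Delta)%E.
Proof.
apply: ge_ereal_sup => _ [r [psi [psi_mono /ereal_sup_lne_le upper
  /ereal_sup_lne_le lower]]] <-.
have mpsi : measurable_fun [set: measurableTypeR R] psi by exact: homo_measurable.
have msh (s : R) : measurable_fun [set: measurableTypeR R] (fun x => psi (x + s)).
  by apply: homo_measurable => x y xy; rewrite psi_mono// lerD2r.
rewrite /two_point_exponent leeNr -EFinN; apply: lne_le.
apply: ge_ereal_sup => _ [Pm [Pp [Cm Cp ->]]].
have [Qm Qm0 intm] := moment_class_center Cm.
have [Qp Qp0 intp] := moment_class_center Cp.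
have half (x : \bar R) : (x = 2^-1%:E * x + 2^-1%:E * x)%E.
  by rewrite -ge0_muleDl ?lee_fin// -EFinD (_ : 2^-1 + 2^-1 = 1 :> R) ?mul1e//; lra.
(* The weights [e^psi / 2] and [e^-psi / 2] satisfy [4 a b = 1]; each integral will contribute at
   most half of [e^-r]. *)
apply: (@le_trans _ _ (\int[Pm]_x (2^-1 * expR (psi x))%:E +
    \int[Pp]_x (2^-1 * expR (- psi x))%:E)%E).
  apply: hellinger_affinity_le.
- by apply: measurable_funM => //; exact: measurableT_comp.
- apply: measurable_funM => //; apply: measurableT_comp => //.
  exact: measurableT_comp.
- by move=> x; rewrite mulr_ge0 ?expR_ge0.
- by move=> x; rewrite mulr_ge0 ?expR_ge0.
- move=> x; rewrite (_ : 4 * _ = expR (psi x) * expR (- psi x)).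
    by rewrite -expRD subrr expR0.
  by field.
rewrite [leRHS]half.
under eq_integral do rewrite EFinM.
under [X in (_ + X <= _)%E]eq_integral do rewrite EFinM.
rewrite !ge0_integralZl//; last 2 first.
- by apply/measurable_EFinP; apply: measurableT_comp => //; exact: measurableT_comp.
- by apply/measurable_EFinP; exact: measurableT_comp.
rewrite leeD// lee_wpmul2l//.
- have := upper _ Qm0; rewrite unlock intm.
  + by under [X in (X <= _)%E -> _]eq_integral do rewrite opprK addrK.
  + by apply: measurableT_comp => //; exact: msh.
  + by move=> x; exact: expR_ge0.
- have := lower _ Qp0; rewrite unlock intp.
  + by under [X in (X <= _)%E -> _]eq_integral do rewrite subrK.
  + by apply: measurableT_comp => //; apply: measurableT_comp => //; exact: msh.
  + by move=> x; exact: expR_ge0.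
Qed.

End monotone_M_upper_bound.

(** * Duality between two-point configurations and multipliers *)

Section duality.
Context {R : realType} (phi : R -> R) (B Delta : R).
Hypotheses (phi_even : forall x, phi (- x) = phi x) (phi_cont : continuous phi).
Implicit Types L : seq (R * {nonneg R} * {nonneg R}).

(* An entry [(t, a, b)] stands for masses [a] of [P_-] and [b] of [P_+] at [t],
   before normalisation and symmetrisation. *)
Definition mass L : R := \sum_(p <- L) (p.1.2%:num + p.2%:num).

Definition affinity L : R := \sum_(p <- L) Num.sqrt (p.1.2%:num * p.2%:num).

(** The shift of [P_-] away from [- Delta] minus that of [P_+] away from [Delta]; symmetrisation
    makes these shifts opposite, so one equation fixes both means. *)
Definition drift L : R :=
  \sum_(p <- L) (p.1.2%:num * (p.1.1 + Delta) - p.2%:num * (p.1.1 - Delta)).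

Definition cost L : R :=
  \sum_(p <- L) (p.1.2%:num * (phi (p.1.1 + Delta) - B) +
                 p.2%:num * (phi (p.1.1 - Delta) - B)).

Lemma moment_class_atomic (mu : R) (L : seq (R * {nonneg R}))
    (P : probability (measurableTypeR R) R) :
  (P : set (measurableTypeR R) -> \bar R) = atomic L ->
  \sum_(p <- L) p.2%:num * p.1 = mu ->
  \sum_(p <- L) p.2%:num * phi (p.1 - mu) <= B ->
  moment_class phi B mu P.
Proof.
move=> PL Lmu LB.
have mid : measurable_fun [set: measurableTypeR R] (fun x => x : R) by [].
split.
- exact: (integrable_atomic PL mid).
- by rewrite (integral_atomic PL mid) Lmu.
- rewrite (integral_atomic PL (f := fun x => phi (x - mu))) ?lee_fin//.
  apply: (measurableT_comp (f := phi)); first exact: continuous_measurable_fun.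
  exact: measurable_funB.
Qed.

(** Adding to each entry [(t, a, b)] its mirror [(- t, b, a)] and dividing by the mass makes [Pp]
    the reflection of [Pm]. Each entry then counts twice in the affinity, whence the factor [2]. *)
Lemma exists_pair_of_configuration L : 0 < mass L -> drift L = 0 ->
  cost L <= 0 ->
  exists Pm Pp : probability (measurableTypeR R) R,
    [/\ moment_class phi B (- Delta) Pm, moment_class phi B Delta Pp &
        ((2 * affinity L / mass L)%:E <= hellinger_affinity Pm Pp)%E].
Proof.
move=> N0 L0 LB.
have N1 : 0 <= (mass L)^-1 by rewrite invr_ge0 ltW.
pose c : {nonneg R} := NngNum N1.
have cN : c%:num * mass L = 1 by rewrite /= mulVf// gt_eqF.
have sc0 (a : {nonneg R}) : 0 <= c%:num * a%:num by [].
pose sc (a : {nonneg R}) : {nonneg R} := NngNum (sc0 a).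
pose L1 := [seq (p.1.1, sc p.1.2, sc p.2) | p <- L] ++
           [seq (- p.1.1, sc p.2, sc p.1.2) | p <- L].
pose Lm := [seq p.1 | p <- L1]; pose Lp := [seq (p.1.1, p.2) | p <- L1].
have sumLm (h : R -> R) : \sum_(p <- Lm) p.2%:num * h p.1 =
    c%:num * \sum_(p <- L) (p.1.2%:num * h p.1.1 + p.2%:num * h (- p.1.1)).
  rewrite big_map big_cat/= !big_map -big_split/= mulr_sumr.
  by apply: eq_bigr => p _ /=; ring.
have sumLp (h : R -> R) : \sum_(p <- Lp) p.2%:num * h p.1 =
    c%:num * \sum_(p <- L) (p.2%:num * h p.1.1 + p.1.2%:num * h (- p.1.1)).
  rewrite big_map big_cat/= !big_map -big_split/= mulr_sumr.
  by apply: eq_bigr => p _ /=; ring.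
have [Pm PmE] : exists P : probability (measurableTypeR R) R,
    (P : set (measurableTypeR R) -> \bar R) = atomic Lm.
  apply: atomic_probability; under eq_bigr do rewrite -[_%:num]mulr1.
  rewrite (sumLm (cst 1)) -[RHS]cN; congr (_ * _); apply: eq_bigr => p _ /=.
  by rewrite !mulr1.
have [Pp PpE] : exists P : probability (measurableTypeR R) R,
    (P : set (measurableTypeR R) -> \bar R) = atomic Lp.
  apply: atomic_probability; under eq_bigr do rewrite -[_%:num]mulr1.
  rewrite (sumLp (cst 1)) -[RHS]cN; congr (_ * _); apply: eq_bigr => p _ /=.
  by rewrite !mulr1 addrC.
have cD : c%:num * (drift L - Delta * mass L) = - Delta.
  by rewrite L0 sub0r mulrN mulrCA cN mulr1.
have cB : c%:num * (cost L + B * mass L) <= B.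
  rewrite mulrDr mulrCA cN mulr1 gerDr.
  by rewrite mulr_ge0_le0.
exists Pm, Pp; split.
- apply: (moment_class_atomic PmE).
    rewrite (sumLm id) -cD; congr (_ * _).
    rewrite /drift /mass mulr_sumr -sumrB; apply: eq_bigr => p _; ring.
  rewrite (sumLm (fun x => phi (x - - Delta))).
  rewrite [leLHS](_ : _ = c%:num * (cost L + B * mass L)) //; congr (_ * _).
  rewrite /cost /mass mulr_sumr -big_split; apply: eq_bigr => p _ /=.
  (* By evenness the mirrored atom at [- t] costs [phi (t - Delta)]. *)
  rewrite opprK -(phi_even (- _ + _)) opprD opprK; ring.
- apply: (moment_class_atomic PpE).
    rewrite (sumLp id) -[RHS]opprK -cD -mulrN; congr (_ * _).
    rewrite /drift /mass mulr_sumr -sumrB -sumrN; apply: eq_bigr => p _; ring.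
  rewrite (sumLp (fun x => phi (x - Delta))).
  rewrite [leLHS](_ : _ = c%:num * (cost L + B * mass L)) //; congr (_ * _).
  rewrite /cost /mass mulr_sumr -big_split; apply: eq_bigr => p _ /=.
  rewrite -(phi_even (- _ - _)) opprD !opprK; ring.
- apply: le_trans (hellinger_affinity_atomic_ge PmE PpE).
  rewrite lee_fin big_cat/= !big_map -big_split/=.
  rewrite [leRHS](_ : _ = 2 * affinity L / mass L)// mulrAC mulr_sumr.
  apply: eq_bigr => p _ /=.
  have sE (a b : {nonneg R}) : Num.sqrt ((mass L)^-1 * a%:num * ((mass L)^-1 * b%:num)) =
      (mass L)^-1 * Num.sqrt (a%:num * b%:num).
    by rewrite mulrACA -expr2 sqrtrM ?sqr_ge0// sqrtr_sqr ger0_norm.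
  by rewrite !sE (mulrC p.2%:num); ring.
Qed.

Lemma two_point_exponent_weak_duality (r : R) L :
  (r%:E <= two_point_exponent phi B Delta)%E -> drift L = 0 -> cost L <= 0 ->
  2 * expR r * affinity L <= mass L.
Proof.
move=> rle L0 LB.
have S0 : 0 <= affinity L by apply: sumr_ge0 => p _; exact: sqrtr_ge0.
(* AM-GM settles the case of zero mass, where normalisation is impossible. *)
have SN : 2 * affinity L <= mass L.
  rewrite mulr_sumr; apply: ler_sum => p _.
  have a0 : 0 <= p.1.2%:num :> R by [].
  have b0 : 0 <= p.2%:num :> R by [].
  rewrite sqrtrM// -{2}(sqr_sqrtr a0) -{2}(sqr_sqrtr b0) -subr_ge0.
  move: (Num.sqrt _) (Num.sqrt _) => x y.
  by rewrite (_ : _ - _ = (x - y) ^+ 2) ?sqr_ge0//; ring.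
have [N0|N0] := ltP 0 (mass L); last first.
  have -> : affinity L = 0 by lra.
  by rewrite mulr0; lra.
have [Pm [Pp [Cm Cp rho]]] := exists_pair_of_configuration N0 L0 LB.
have : (hellinger_affinity Pm Pp <= (expR (- r))%:E)%E.
  apply: le_trans (le_expR _); last first.
    by rewrite EFinN leeNr; exact: rle.
  by apply: ereal_sup_ubound; exists Pm, Pp.
move=> /(le_trans rho); rewrite lee_fin ler_pdivrMr// => h.
rewrite -(ler_pM2l (expR_gt0 (- r))).
rewrite (_ : expR (- r) * (2 * expR r * _) =
  2 * affinity L * (expR (- r) * expR r)); last by ring.
by rewrite -expRD addNr expR0 mulr1.
Qed.

Hypothesis phi0_lt_B : phi 0 < B.

(** Configurations form a cone under concatenation and scaling of masses. Separation gives
    multipliers, and testing them on single entries gives the pointwise inequalities. *)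
Lemma multipliers_of_two_point_exponent (r : R) :
  (r%:E <= two_point_exponent phi B Delta)%E ->
  exists2 la : R * R, 0 <= la.2 &
    (forall x, 0 <= g_u phi B la x) /\ (forall x, 0 <= g_l phi B la x) /\
    forall t, expR r ^+ 2 <= g_u phi B la (t + Delta) * g_l phi B la (t - Delta).
Proof.
move=> rle; set k := expR r.
pose gap L := mass L - 2 * k * affinity L.
pose K c m s := exists L, [/\ gap L = c, drift L = m & cost L = s].
have K1 t (a b : {nonneg R}) :
    K (a%:num + b%:num - 2 * k * Num.sqrt (a%:num * b%:num))
      (a%:num * (t + Delta) - b%:num * (t - Delta))
      (a%:num * (phi (t + Delta) - B) + b%:num * (phi (t - Delta) - B)).
  exists [:: (t, a, b)].
  by rewrite /gap /mass /affinity /drift /cost !big_seq1.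
have [l1 [l2 [l20 lP]]] : exists l1 l2, 0 <= l2 /\
    forall c m s, K c m s -> 0 <= c + l1 * m + l2 * s.
  apply: cone_multiplier2.
  - move=> c m s c' m' s' [L [<- <- <-]] [L' [<- <- <-]]; exists (L ++ L').
    rewrite /gap /mass /affinity /drift /cost !big_cat/=.
    by split => //; ring.
  - move=> a c m s a0 [L [<- <- <-]].
    have sc0 (x : {nonneg R}) : 0 <= a * x%:num by rewrite mulr_ge0// ltW.
    pose sc (x : {nonneg R}) : {nonneg R} := NngNum (sc0 x).
    exists [seq (p.1.1, sc p.1.2, sc p.2) | p <- L].
    rewrite /gap /mass /affinity /drift /cost !big_map.
    split.
    + rewrite mulrBr mulrCA !mulr_sumr; congr (_ - _); apply: eq_bigr => p _ /=.
        by ring.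
      rewrite mulrACA -expr2 sqrtrM ?sqr_ge0// sqrtr_sqr ger0_norm//.
      exact: ltW.
    + by rewrite mulr_sumr; apply: eq_bigr => p _ /=; ring.
    + by rewrite mulr_sumr; apply: eq_bigr => p _ /=; ring.
  - move=> c s [L [<- L0 <-]] LB; rewrite subr_ge0.
    exact: two_point_exponent_weak_duality.
  (* A unit mass of [P_-] at [1 - Delta], [-1 - Delta] or [- Delta] has drift [1], [-1] or [0]; the
     last has cost [phi 0 - B < 0]. *)
  - do 3 eexists; split; first exact: (K1 (1 - Delta) 1%:nng 0%:nng).
    by rewrite /= mul0r subr0 mul1r subrK.
  - do 3 eexists; split; first exact: (K1 (-1 - Delta) 1%:nng 0%:nng).
    by rewrite /= mul0r subr0 mul1r subrK ltrN10.
  - have := K1 (- Delta) 1%:nng 0%:nng.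
    rewrite /= addNr mulr0 mul0r subr0 => K1D.
    do 2 eexists; split; first exact: K1D.
    by rewrite mul1r mul0r addr0 subr_lt0.
(* With masses [a ^+ 2] and [b ^+ 2] the affinity of an entry is [a * b], so the inequality becomes
   a quadratic form. *)
have form t a b : 0 <= a -> 0 <= b ->
    2 * k * (a * b) <= a ^+ 2 * g_u phi B (l1, l2) (t + Delta) +
                       b ^+ 2 * g_l phi B (l1, l2) (t - Delta).
  move=> a0 b0.
  have h := lP _ _ _ (K1 t (NngNum (sqr_ge0 a)) (NngNum (sqr_ge0 b))).
  rewrite /= -exprMn sqrtr_sqr ger0_norm ?mulr_ge0// in h.
  rewrite -subr_ge0; apply: etrans h; congr (0 <= _).
  by rewrite /g_u /g_l/=; ring.
have gu0 x : 0 <= g_u phi B (l1, l2) x.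
  have := form (x - Delta) 1 0 ler01 (lexx 0).
  by rewrite !mulr0 expr0n/= mul0r addr0 expr1n mul1r subrK.
have gl0 x : 0 <= g_l phi B (l1, l2) x.
  have := form (x + Delta) 0 1 (lexx 0) ler01.
  by rewrite mul0r mulr0 expr0n/= mul0r add0r expr1n mul1r addrK.
exists (l1, l2) => //; split => //; split => // t.
by apply: ge_sqr_of_quadratic_form => //; [exact: expR_gt0|exact: form].
Qed.

End duality.

(** * The cycle of inequalities between the three rates *)

Theorem theorem2 (R : realType) (phi : R -> R) (B : R)
  (phi_ge0 : forall x, 0 <= phi x)
  (phi_even : forall x, phi (- x) = phi x)
  (phi_cont : continuous phi)
  (phi_ndecr : {in `[0, +oo[ &, {homo phi : x y / x <= y}})
  (phi_superlin_pos : phi x / `|x| @[x --> +oo] --> +oo)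
  (phi_superlin_neg : phi x / `|x| @[x --> -oo] --> +oo)
  (phi0_lt_B : phi 0 < B)
  (Delta : R) (Delta_gt0 : 0 < Delta) :
  [/\ (two_point_exponent phi B Delta <= synthesis_rate phi B Delta)%E,
      (synthesis_rate phi B Delta <= monotone_M_rate phi B Delta)%E &
      (monotone_M_rate phi B Delta <= two_point_exponent phi B Delta)%E].
Proof.
split; last 2 first.
- exact: synthesis_rate_le_monotone_M_rate.
- exact: monotone_M_rate_le_two_point_exponent.
(* The exponent may be infinite, so it is compared through the reals below it. *)
have real_le (r : R) : (r%:E <= two_point_exponent phi B Delta)%E ->
    (r%:E <= synthesis_rate phi B Delta)%E.
  move=> /(multipliers_of_two_point_exponent phi_even phi_cont phi0_lt_B).
  move=> [la l20 [gu0 [gl0 gk]]].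
  have e0 : 0 < expR r ^+ 2 by rewrite exprn_gt0 ?expR_gt0.
  have [la' Cla' gk'] :=
    synthesis_of_antidiagonal phi_even phi_ndecr Delta_gt0 l20 e0 gu0 gl0 gk.
  exact: (synthesis_rate_ge Cla').
case E : (two_point_exponent phi B Delta) real_le => [r| |] real_le.
- exact: real_le.
- by rewrite leye_eq; apply/eqP/eqyP => A _; apply: real_le; rewrite leey.
- exact: leNye.
Qed.
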